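(* For every graph $G$ we have $$\chi_v(G) \le \chi_q(G) \le \frac{\pi}{2}\, \chi_v(G).$$
   Context: All graphs are finite, undirected, loopless, and have at least one edge. For $W \subseteq V(G)$, $\delta(W)$ denotes the set of edges of $G$ with exactly one end in $W$; a cut of $G$ is any edge set of the form $\delta(W)$. For positive integers $n,k$, an $n/k$-cover of $G$ is an $n$-tuple $(X_1,\dots,X_n)$ of cuts in $G$ (repetitions allowed) such that every edge of $G$ lies in at least $k$ of them. The fractional cut-covering number is $x(G) = \inf\{ n/k \mid \text{there exists an } n/k\text{-cover of } G\}$ (it always satisfies $x(G)<2$), and the cubical chromatic number is $\chi_q(G) = \frac{2}{2-x(G)}$. Vector chromatic number: let $n=|V(G)|$ and let $t(G)$ be the minimum real $t<0$ for which there is a mapping $f: V(G) \to \mathbb{R}^n$ with $\|f(v)\|_2 = 1$ for every vertex $v$ and $\langle f(u), f(v)\rangle \le t$ for every edge $uv$. Then $\chi_v(G) = 1 - \frac{1}{t(G)}$. *)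

(* Defs.v *)
From mathcomp Require Import all_boot all_order all_algebra.
From mathcomp Require Import all_classical all_reals all_analysis.

Set Implicit Arguments.
Unset Strict Implicit.
Unset Printing Implicit Defensive.

Import Order.TTheory GRing.Theory Num.Theory.

Local Open Scope classical_set_scope.
Local Open Scope ring_scope.

(* Parallel edges are allowed. Loops are excluded because every edge has
   exactly two ends. *)
Record graph := Graph {
  vertex : finType;
  edge : finType;
  ends : edge -> {set vertex};
  card_ends : forall e, #|ends e| = 2%N
}.

Definition delta (G : graph) (W : {set vertex G}) : {set edge G} :=
  [set e | #|ends e :&: W|%SET == 1%N]%SET.

Definition is_cut (G : graph) (X : {set edge G}) : Prop :=
  exists W : {set vertex G}, X = delta W.

Definition is_cover (G : graph) (n k : nat) (X : n.-tuple {set edge G}) : Prop :=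
  (forall i : 'I_n, is_cut (tnth X i)) /\
  (forall e : edge G, (k <= #|[set i : 'I_n | e \in tnth X i]%SET|)%N).

Definition cover_ratios (R : realType) (G : graph) : set R :=
  [set r | exists n k : nat, [/\ (0 < n)%N, (0 < k)%N,
     exists X : n.-tuple {set edge G}, is_cover k X & r = n%:R / k%:R]].

Definition frac_cut_cover (R : realType) (G : graph) : R :=
  inf (@cover_ratios R G).

Definition cubical_chi (R : realType) (G : graph) : R :=
  2 / (2 - frac_cut_cover R G).

(* The library norm on 'rV[R]_n is the sup norm, hence an explicit Euclidean
   structure. *)
Definition dot (R : realType) (n : nat) (u v : 'rV[R]_n) : R :=
  \sum_(i < n) u 0 i * v 0 i.

Definition norm2 (R : realType) (n : nat) (u : 'rV[R]_n) : R :=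
  Num.sqrt (dot u u).

Definition vector_values (R : realType) (G : graph) : set R :=
  [set t | t < 0 /\ exists f : vertex G -> 'rV[R]_#|vertex G|,
     (forall v, norm2 (f v) = 1) /\
     (forall (e : edge G) (u v : vertex G), ends e = [set u; v]%SET ->
        dot (f u) (f v) <= t)].

(* The minimum itself (an attained lower bound), not merely the infimum; the
   default value 0 is used only if there is no minimum. *)
Definition vector_t (R : realType) (G : graph) : R :=
  xget 0 (@vector_values R G `&` lbound (@vector_values R G)).

Definition vector_chi (R : realType) (G : graph) : R := 1 - 1 / vector_t R G.

(* Main.v *)
Require Import Defs.
From mathcomp Require Import all_boot all_order all_algebra.
From mathcomp Require Import all_classical all_reals all_analysis.
From mathcomp Require Import measurable_realfun.
From mathcomp Require Import ring lra.

(** Write t < 0 for the optimal value of the vector program and x for the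
fractional cut-covering number.

Lower bound.  A cover by n cuts gives each vertex the vector of its sides,
with entries +-1/sqrt n.  If every edge is cut at least k times, adjacent
vertices have inner product at most 1 - 2k/n.  These vectors live in dimension
n, but finitely many vectors depend on their Gram matrix only up to isometry,
so they fit in dimension |V| ([gram_realization]).  Hence t <= 1 - 2k/n as soon
as the right-hand side is negative, which gives x >= 2/(1 - t)
([frac_cut_cover_ge_vector]) and then 1 - 1/t <= 2/(2 - x).

Upper bound.  Optimal vectors are rounded by a random hyperplane: with a
standard Gaussian g, the cut puts v on the side of the sign of <g, f v>.  Two
unit vectors with inner product r <= 0 are separated with probability
1/2 + asin(-r)/pi, which is at least 1/2 - r/pi.  So there is a probability
distribution on cuts that hits every edge with probability at least
q = 1/2 - t/pi ([hyperplane_rounding]); rounding its weights to multiples of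
1/N gives covers whose ratio tends to 1/q, whence x q <= 1
([frac_cut_cover_distribution]).  Since t < 0 this forces x < 2, and
2/(2 - x) <= 1 - pi/(2t), which is at most (pi/2)(1 - 1/t) because pi >= 2.

The separation probability rests on the rotation invariance of the Gaussian
measure of the plane.  A rotation of the plane splits into one-variable affine
substitutions, so Tonelli's theorem and the scaling of Lebesgue measure give
the invariance ([gauss_rotation]).  Independent Gaussians in n dimensions are
added one coordinate at a time, and after each step two planar rotations bring
a pair of linear forms back to the triangular shape
(al x, be x + ga y) of a pair in the plane ([gauss_vector]).

The minimum t is attained because the admissible pairs of a vector assignment
and a bound form a compact set ([vector_tP]). *)

Set Implicit Arguments.
Unset Strict Implicit.
Unset Printing Implicit Defensive.

Import Order.TTheory GRing.Theory Num.Theory.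
Import numFieldNormedType.Exports.

Local Open Scope classical_set_scope.
Local Open Scope ring_scope.

(** * Affine changes of variable for Lebesgue measure *)

Section affine.
Context {R : realType}.
Local Notation mu := (@lebesgue_measure R).
Local Open Scope ereal_scope.

Lemma measurable_affine (a b : R) :
  measurable_fun [set: measurableTypeR R]
    (fun x => (a * x + b)%R : measurableTypeR R).
Proof. by apply: measurable_funD => //; exact: measurable_funM. Qed.

(** Uniqueness of Lebesgue measure reduces the scaling law to half-open
intervals, whose preimages are again intervals, reversed when the slope is
negative. *)
Lemma lebesgue_affine (a b : R) (A : set R) :
  a != 0%R -> measurable A ->
  mu A = `|a|%:E * mu ((fun x : R => (a * x + b)%R) @^-1` A).
Proof.
move=> a0 mA.
have na : (0 <= `|a|)%R by [].
have mphi := @measurable_affine a b.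
(* A pushforward is a measure once its map is known to be measurable; m0 awaits
   that proof. *)
pose m0 : {measure set (measurableTypeR R) -> \bar R} :=
  mscale (NngNum na) (pushforward mu (fun x : R => (a * x + b)%R : measurableTypeR R)).
pose m := m0 mphi.
suff H : forall X, ocitv X -> mu X = m X.
  exact: (lebesgue_measure_unique H).
move=> _ [[p q] _ <-]/=.
rewrite /m /m0/= /mscale/= /pushforward/= lebesgue_measure_itv/= lte_fin.
have an : (0 < `|a|)%R by rewrite normr_gt0.
have [ap|an0] := ltrP 0%R a.
  rewrite (_ : _ @^-1` _ = `]((p - b) / a)%R, ((q - b) / a)%R]%classic :> set R); last first.
    apply/seteqP; split => x /=; rewrite !in_itv/= ltr_pdivrMr// ler_pdivlMr// => /andP[? ?]; lra.
  rewrite lebesgue_measure_itv/= lte_fin ltr_pM2r ?invr_gt0// ltrD2r.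
  case: ifPn => _; last by rewrite mule0.
  by rewrite -!EFinB -EFinM gtr0_norm//; congr EFin; field.
have {an0} an0 : (a < 0)%R by rewrite lt_neqAle a0.
rewrite (_ : _ @^-1` _ = `[((q - b) / a)%R, ((p - b) / a)%R[%classic :> set R); last first.
  apply/seteqP; split => x /=; rewrite !in_itv/= ltr_ndivlMr// ler_ndivrMr// => /andP[? ?]; lra.
rewrite lebesgue_measure_itv/= lte_fin ltr_nM2r ?invr_lt0// ltrD2r.
case: ifPn => _; last by rewrite mule0.
by rewrite -!EFinB -EFinM ltr0_norm//; congr EFin; field.
Qed.

Lemma ge0_integral_affine (a b : R) (h : R -> \bar R) :
  a != 0%R -> measurable_fun setT h -> (forall x, 0 <= h x) ->
  \int[mu]_x h x = `|a|%:E * \int[mu]_x h (a * x + b)%R.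
Proof.
move=> a0 mh h0.
have na : (0 <= `|a|)%R by [].
have mphi := @measurable_affine a b.
transitivity (`|a|%:E * \int[pushforward mu
    (fun x : R => (a * x + b)%R : measurableTypeR R)]_x h x); last first.
  by rewrite ge0_integral_pushforward.
rewrite -(ge0_integral_mscale _ _ (NngNum na))//.
apply: eq_measure_integral => A mA _.
exact: (lebesgue_affine b a0 mA).
Qed.
End affine.

(** * The standard Gaussian law *)

Section gaussian.
Context {R : realType}.
Local Notation mu := (@lebesgue_measure R).
Local Open Scope ereal_scope.

Definition gauss : probability (measurableTypeR R) R := normal_prob 0 1.
Definition gauss_pdf : R -> R := normal_pdf 0 1.

(** The Radon-Nikodym derivative of the Gaussian law is only determined almost
everywhere; this identifies it with the explicit density. *)
Lemma ge0_integral_gauss (h : R -> \bar R) :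
  measurable_fun setT h -> (forall x, 0 <= h x) ->
  \int[gauss]_x h x = \int[mu]_x (h x * (gauss_pdf x)%:E).
Proof.
move=> mh h0.
have dom : gauss `<< mu by exact: normal_prob_dominates.
rewrite -(Radon_Nikodym_SigmaFinite.change_of_variables dom)//.
apply: ae_eq_integral => //.
- apply: emeasurable_funM => //.
  exact: measurable_int (Radon_Nikodym_SigmaFinite.f_integrable dom).
- apply: emeasurable_funM => //; apply/measurable_EFinP.
  exact: measurable_normal_pdf.
- have : ae_eq mu setT (Radon_Nikodym_SigmaFinite.f gauss mu) (EFin \o gauss_pdf).
    apply: integral_ae_eq => //.
    + exact: Radon_Nikodym_SigmaFinite.f_integrable.
    + apply/measurable_EFinP; exact: measurable_normal_pdf.
    + by move=> E _ mE; rewrite -Radon_Nikodym_SigmaFinite.f_integral.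
  by apply: filterS => x /= + _ => ->.
Qed.

(** The joint density depends on x^2 + y^2 only: this is the source of the
rotation invariance. *)
Lemma gauss_pdfM (x y : R) :
  (gauss_pdf x * gauss_pdf y = (pi *+ 2)^-1 * expR (- (x ^+ 2 + y ^+ 2) / 2))%R.
Proof.
rewrite /gauss_pdf normal_pdfE ?oner_eq0// /normal_peak /normal_fun.
rewrite mulrACA -expRD !subr0 !expr1n !mul1r; congr (_ * expR _)%R; last by lra.
by rewrite -invfM -expr2 sqr_sqrtr// mulrn_wge0// pi_ge0.
Qed.

Lemma gauss_pdf_ge0 (x : R) : (0 <= gauss_pdf x)%R.
Proof. exact: normal_pdf_ge0. Qed.

Lemma measurable_gauss_pdf : measurable_fun setT gauss_pdf.
Proof. exact: measurable_normal_pdf. Qed.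

End gaussian.

(** * Rotation invariance of the planar Gaussian law *)

Section rotation.
Context {R : realType}.
Local Notation mu := (@lebesgue_measure R).
Local Notation RR := (measurableTypeR R).
Local Open Scope ereal_scope.

Lemma measurable_linear2 (a b : R) :
  measurable_fun setT (fun z : RR * RR => (a * z.1 + b * z.2)%R : RR).
Proof. by apply: measurable_funD; apply: measurable_funM. Qed.

Lemma measurable_linear_map (a b c d : R) : measurable_fun setT
  (fun z : RR * RR => ((a * z.1 + b * z.2)%R : RR, (c * z.1 + d * z.2)%R : RR)).
Proof. by apply: measurable_fun_pair; exact: measurable_linear2. Qed.

(** For a <> 0 the rotation is a composition of two substitutions in one variable
each: first y, with x fixed, then x, with the new second coordinate fixed.
Their Jacobians |a|^-1 and |a| cancel. *)
Lemma lebesgue_rotation (a b : R) (K : RR * RR -> \bar R) :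
  a != 0%R -> (a ^+ 2 + b ^+ 2 = 1)%R ->
  measurable_fun setT K -> (forall z, 0 <= K z) ->
  \int[mu]_x \int[mu]_y K (a * x + b * y, - b * x + a * y)%R =
  \int[mu]_x \int[mu]_y K (x, y).
Proof.
move=> a0 ab mK K0.
pose K' (z : RR * RR) := K (a^-1 * z.1 + (b / a) * z.2, 0 * z.1 + 1 * z.2)%R.
have mK' : measurable_fun setT K'.
  exact: (measurableT_comp _ (measurable_linear_map _ _ _ _)).
have K'0 z : 0 <= K' z by exact: K0.
have na : (`|a| != 0)%R by rewrite normr_eq0.
transitivity (\int[mu]_x (`|a|^-1%:E * \int[mu]_y K' (x, y))).
  apply: eq_integral => x _.
  rewrite (@ge0_integral_affine _ a (- b * x) (fun y => K' (x, y)))//; last first.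
    exact: (measurableT_comp _ (measurable_pair1 x)).
  rewrite muleA -EFinM mulVf// mul1e; apply: eq_integral => y _.
  rewrite /K'/=; congr (K (_, _)); last by rewrite mul0r add0r mul1r addrC.
  transitivity ((1 - b ^+ 2) / a * x + b * y)%R; last by field.
  by rewrite -ab addrK; field.
rewrite ge0_integralZl//=; last 2 first.
- exact: (measurable_fun_fubini_tonelli_F (m2 := mu) _ mK').
- by move=> x _; exact: integral_ge0.
rewrite (fubini_tonelli (m1 := mu) (m2 := mu) K')//.
rewrite (fubini_tonelli (m1 := mu) (m2 := mu) K)//.
rewrite -ge0_integralZl//=; last 2 first.
- exact: (measurable_fun_fubini_tonelli_G (m1 := mu) _ mK').
- by move=> x _; exact: integral_ge0.
apply: eq_integral => y _.
rewrite [RHS](@ge0_integral_affine _ a^-1 (b / a * y) (fun x => K (x, y)))//; last 2 first.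
- by rewrite invr_eq0.
- exact: (measurableT_comp _ (measurable_pair2 y)).
rewrite normfV; congr (_ * _); apply: eq_integral => x _.
by rewrite /K'/= mul0r add0r mul1r.
Qed.

(** The Gaussian density is invariant under the rotation, so it can be moved into
the integrand of the Lebesgue statement. *)
Lemma gauss_rotation_neq0 (a b : R) (H : RR * RR -> \bar R) :
  a != 0%R -> (a ^+ 2 + b ^+ 2 = 1)%R ->
  measurable_fun setT H -> (forall z, 0 <= H z) ->
  \int[gauss]_x \int[gauss]_y H (a * x + b * y, - b * x + a * y)%R =
  \int[gauss]_x \int[gauss]_y H (x, y).
Proof.
move=> a0 ab.
have dens (F : RR * RR -> \bar R) : measurable_fun setT F -> (forall z, 0 <= F z) ->
    \int[gauss]_x \int[gauss]_y F (x, y) =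
    \int[mu]_x \int[mu]_y (F (x, y) * (gauss_pdf x * gauss_pdf y)%:E).
  move=> mF F0; rewrite ge0_integral_gauss; last 2 first.
  - exact: (measurable_fun_fubini_tonelli_F (m2 := gauss) _ mF).
  - by move=> x; exact: integral_ge0.
  apply: eq_integral => x _; rewrite ge0_integral_gauss//; last first.
    exact: (measurableT_comp _ (measurable_pair1 x)).
  rewrite muleC -ge0_integralZl//=.
  - by apply: eq_integral => y _; rewrite muleCA EFinM.
  - apply: emeasurable_funM; last by apply/measurable_EFinP; exact: measurable_gauss_pdf.
    exact: (measurableT_comp _ (measurable_pair1 x)).
  - by move=> y _; rewrite mule_ge0// lee_fin gauss_pdf_ge0.
  - by rewrite lee_fin gauss_pdf_ge0.
move=> mH H0.
pose K (z : RR * RR) := H z * (gauss_pdf z.1 * gauss_pdf z.2)%:E.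
rewrite (dens (fun z => H (a * z.1 + b * z.2, - b * z.1 + a * z.2)%R))//; last first.
  exact: (measurableT_comp _ (measurable_linear_map _ _ _ _)).
rewrite (dens H mH H0) -(@lebesgue_rotation a b K a0 ab); last 2 first.
- apply: emeasurable_funM => //; apply/measurable_EFinP.
  apply: measurable_funM.
    exact: (measurableT_comp measurable_gauss_pdf measurable_fst).
  exact: (measurableT_comp measurable_gauss_pdf measurable_snd).
- by move=> z; rewrite mule_ge0// lee_fin mulr_ge0// gauss_pdf_ge0.
apply: eq_integral => x _; apply: eq_integral => y _.
rewrite /K/= !gauss_pdfM; congr (_ * (_ * expR (- _ / 2))%:E).
by rewrite -[LHS]mul1r -ab; ring.
Qed.

(** The excluded case a = 0 is a quarter turn, which is an eighth of a turn done
twice. *)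
Lemma gauss_rotation (a b : R) (H : RR * RR -> \bar R) :
  (a ^+ 2 + b ^+ 2 = 1)%R ->
  measurable_fun setT H -> (forall z, 0 <= H z) ->
  \int[gauss]_x \int[gauss]_y H (a * x + b * y, - b * x + a * y)%R =
  \int[gauss]_x \int[gauss]_y H (x, y).
Proof.
move=> ab mH H0; have [a0|a0] := eqVneq a 0%R; last exact: gauss_rotation_neq0.
pose r : R := (Num.sqrt 2)^-1%R.
have r2 : (r ^+ 2 = 2^-1)%R by rewrite /r exprVn sqr_sqrtr.
have r0 : (r != 0)%R by rewrite /r invr_eq0 sqrtr_eq0 -ltNge ltr0n.
have b1 : (b ^+ 2 = 1)%R by rewrite -ab a0 expr0n add0r.
have rb : (r ^+ 2 + (r * b) ^+ 2 = 1)%R by rewrite exprMn b1 r2; lra.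
rewrite -[RHS](gauss_rotation_neq0 r0 rb)//.
rewrite -[RHS](@gauss_rotation_neq0 r (r * b) (fun z => H (r * z.1 + r * b * z.2, - (r * b) * z.1 + r * z.2)%R))//; last first.
  exact: (measurableT_comp _ (measurable_linear_map _ _ _ _)).
apply: eq_integral => x _; apply: eq_integral => y _ /=; congr (H (_, _)).
- rewrite a0.
  transitivity ((r ^+ 2 - r ^+ 2 * b ^+ 2) * x + (r ^+ 2 * 2 * b) * y)%R; last by ring.
  by rewrite b1 r2 mulr1 subrr mulVf// mul1r.
- rewrite a0.
  transitivity ((r ^+ 2 - r ^+ 2 * b ^+ 2) * y - (r ^+ 2 * 2 * b) * x)%R; last by ring.
  by rewrite b1 r2 mulr1 subrr mulVf// mul1r; ring.
Qed.
End rotation.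

(** * Pairs of linear forms in Gaussian variables *)

Section gauss_vectors.
Context {R : realType}.
Local Notation RR := (measurableTypeR R).
Local Open Scope ereal_scope.

Lemma rotation_to_axis (x y : R) : exists c s : R,
  (c ^+ 2 + s ^+ 2 = 1)%R /\ (- s * x + c * y = 0)%R.
Proof.
have [x2|x2] := eqVneq (x ^+ 2 + y ^+ 2)%R 0%R.
  exists 1%R, 0%R; split; first by rewrite expr1n expr0n addr0.
  have /andP[_ /eqP] : (x ^+ 2 == 0)%R && (y ^+ 2 == 0)%R.
    by rewrite -paddr_eq0 ?sqr_ge0// x2.
  by move=> /eqP; rewrite sqrf_eq0 => /eqP ->; rewrite mulr0 oppr0 mul0r addr0.
have r2 : (Num.sqrt (x ^+ 2 + y ^+ 2) ^+ 2 = x ^+ 2 + y ^+ 2)%R.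
  by rewrite sqr_sqrtr// addr_ge0// sqr_ge0.
exists (x / Num.sqrt (x ^+ 2 + y ^+ 2))%R, (y / Num.sqrt (x ^+ 2 + y ^+ 2))%R.
split; last by ring.
by rewrite !exprMn !exprVn r2 -mulrDl divff.
Qed.

Lemma integral_gauss_cst (k : \bar R) : \int[gauss]_(_ in setT) k = k.
Proof.
rewrite integral_cst//; transitivity (k * 1); last exact: mule1.
by congr (_ * _); exact: probability_setT.
Qed.

(** A family g of n independent standard Gaussians, known only through the joint
law of any two linear forms in it: that law depends only on the Gram matrix of
the coefficient vectors a and b, and is the law of al x, be x + ga y for
independent Gaussians x and y.  The probability space is quantified
existentially so that the induction can replace it by a product with the line. *)
Lemma gauss_vector n : exists (d : measure_display) (T : measurableType d)
    (P : probability T R) (g : 'I_n -> T -> RR),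
  (forall i, measurable_fun setT (g i)) /\
  forall a b : 'I_n -> R, exists al be ga : R,
  [/\ (al ^+ 2 = \sum_(i < n) a i ^+ 2)%R, (al * be = \sum_(i < n) a i * b i)%R,
      (be ^+ 2 + ga ^+ 2 = \sum_(i < n) b i ^+ 2)%R &
      forall F : RR * RR -> \bar R, measurable_fun setT F -> (forall z, 0 <= F z) ->
      \int[P]_t F (\sum_(i < n) a i * g i t, \sum_(i < n) b i * g i t)%R =
      \int[gauss]_x \int[gauss]_y F (al * x, be * x + ga * y)%R].
Proof.
elim: n => [|n [d [T [P [g [mg IH]]]]]].
  exists _, RR, gauss, (fun _ => id); split=> [//|a b].
  exists 0%R, 0%R, 0%R; split; rewrite ?big_ord0 ?mul0r ?expr0n ?addr0// => F mF F0.
  under eq_integral do rewrite !big_ord0.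
  rewrite integral_gauss_cst; under [RHS]eq_integral => x _.
    under eq_integral do rewrite !mul0r addr0.
    rewrite integral_gauss_cst; over.
  by rewrite integral_gauss_cst.
pose g' (i : 'I_n.+1) (z : RR * T) : RR :=
  if unlift ord0 i is Some j then g j z.2 else z.1.
exists _, (RR * T)%type, (gauss \x P), g'; split.
  move=> i; rewrite /g'; case: (unlift ord0 i) => [j|]; last exact: measurable_fst.
  exact: (measurableT_comp (mg j) measurable_snd).
move=> a b.
(* The new coordinate is a third Gaussian variable.  The first rotation leaves a
   single variable in the first form; the second merges the two variables that
   occur in the second form only. *)
have [al [be [ga [alE abE bgE law]]]] := IH (fun i => a (lift ord0 i)) (fun i => b (lift ord0 i)).
have [c [s [cs axis]]] := rotation_to_axis (a ord0) al.
have [c' [s' [cs' axis']]] := rotation_to_axis (- s * b ord0 + c * be)%R ga.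
exists (c * a ord0 + s * al)%R, (c * b ord0 + s * be)%R, (c' * (- s * b ord0 + c * be) + s' * ga)%R.
rewrite !big_ord_recl/= -alE -abE -bgE; split.
(* Brahmagupta's identity: the terms subtracted vanish by the choice of the
   rotations. *)
- transitivity ((c ^+ 2 + s ^+ 2) * (a ord0 ^+ 2 + al ^+ 2) - (- s * a ord0 + c * al) ^+ 2)%R.
    by ring.
  by rewrite cs axis mul1r expr0n subr0.
- transitivity ((c ^+ 2 + s ^+ 2) * (a ord0 * b ord0 + al * be) - (- s * a ord0 + c * al) * (- s * b ord0 + c * be))%R.
    by ring.
  by rewrite cs axis mul1r mul0r subr0.
- transitivity ((c * b ord0 + s * be) ^+ 2 + (c' ^+ 2 + s' ^+ 2) * ((- s * b ord0 + c * be) ^+ 2 + ga ^+ 2) - (- s' * (- s * b ord0 + c * be) + c' * ga) ^+ 2)%R.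
    by ring.
  rewrite cs' axis' expr0n subr0 mul1r.
  transitivity ((c ^+ 2 + s ^+ 2) * (b ord0 ^+ 2 + be ^+ 2) + ga ^+ 2)%R; first by ring.
  by rewrite cs; ring.
move=> F mF F0.
rewrite fubini_tonelli1//; last first.
  apply: (measurableT_comp mF); apply: measurable_fun_pair; apply: measurable_sum => i;
    apply: measurable_funM => //; rewrite /g'; case: (unlift ord0 i) => [j|]; try exact: measurable_fst;
    exact: (measurableT_comp (mg j) measurable_snd).
pose H1 (z : RR * RR) := \int[gauss]_v F (a ord0 * z.1 + al * z.2, b ord0 * z.1 + (be * z.2 + ga * v))%R.
transitivity (\int[gauss]_x \int[gauss]_u H1 (x, u)).
  apply: eq_integral => x _; rewrite /fubini_F /H1 /=.
  rewrite -(law (fun z => F (a ord0 * x + z.1, b ord0 * x + z.2)%R))//; last first.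
    apply: (measurableT_comp mF); apply: measurable_fun_pair; exact: measurable_funD.
  apply: eq_integral => t _ /=; congr (F (_, _)); rewrite big_ord_recl /g' unlift_none/=.
    by congr (_ + _)%R; apply: eq_bigr => i _; rewrite liftK.
  by congr (_ + _)%R; apply: eq_bigr => i _; rewrite liftK.
have mH1 : measurable_fun setT H1.
  apply: (measurable_fun_fubini_tonelli_F (m2 := gauss) (fun w : (RR * RR) * RR =>
     F (a ord0 * w.1.1 + al * w.1.2, b ord0 * w.1.1 + (be * w.1.2 + ga * w.2))%R)) => //.
  apply: (measurableT_comp mF); apply: measurable_fun_pair.
    exact: (measurableT_comp (measurable_linear2 (a ord0) al) measurable_fst).
  apply: measurable_funD.
    apply: measurable_funM => //; exact: (measurableT_comp measurable_fst measurable_fst).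
  apply: measurable_funD; apply: measurable_funM => //.
  exact: (measurableT_comp measurable_snd measurable_fst).
have H10 z : 0 <= H1 z by exact: integral_ge0.
(* First rotation, in the plane of the new coordinate and of the variable al
   multiplies. *)
rewrite -(@gauss_rotation _ c (- s) H1) ?sqrrN//.
apply: eq_integral => x _; rewrite opprK /H1/=.
transitivity (\int[gauss]_q \int[gauss]_v F ((c * a ord0 + s * al) * x, (c * b ord0 + s * be) * x + ((- s * b ord0 + c * be) * q + ga * v))%R).
  apply: eq_integral => q _; apply: eq_integral => v _; congr (F (_, _)); last by ring.
  transitivity ((c * a ord0 + s * al) * x + (- s * a ord0 + c * al) * q)%R; first by ring.
  by rewrite axis mul0r addr0.
pose H2 (z : RR * RR) := F ((c * a ord0 + s * al) * x, (c * b ord0 + s * be) * x + ((- s * b ord0 + c * be) * z.1 + ga * z.2))%R.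
(* Second rotation, which leaves a variable w that no longer occurs. *)
have H20 z : 0 <= H2 z by exact: F0.
rewrite -(@gauss_rotation _ c' (- s') H2) ?sqrrN//; last first.
  apply: (measurableT_comp mF); apply: measurable_fun_pair => //.
  by apply: measurable_funD => //; exact: measurable_linear2.
apply: eq_integral => y _; rewrite -[RHS]integral_gauss_cst; apply: eq_integral => w _.
rewrite /H2 opprK/=; congr (F (_, _ + _))%R.
transitivity ((c' * (- s * b ord0 + c * be) + s' * ga) * y + (- s' * (- s * b ord0 + c * be) + c' * ga) * w)%R.
  by ring.
by rewrite axis' mul0r addr0.
Qed.
End gauss_vectors.

(** * The Cauchy distribution of slopes *)

Section gauss_wedge.
Context {R : realType}.
Local Notation mu := (@lebesgue_measure R).

Lemma sin_le_id (x : R) : 0 <= x -> sin x <= x.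
Proof.
move=> x0.
have [|c _ h] := @MVT_segment R sin cos 0 x x0 (fun y _ => is_derive_sin y).
  by apply: continuous_subspaceT; exact: continuous_sin.
rewrite sin0 !subr0 in h; rewrite h ler_piMl//; exact: cos_le1.
Qed.

(** The right-hand side is the angle whose sine is s and whose cosine is t. *)
Lemma le_atan_ratio (s t : R) : 0 <= s -> 0 < t -> s ^+ 2 + t ^+ 2 = 1 ->
  s <= atan (s / t).
Proof.
move=> s0 t0 st; have m0 : 0 <= s / t by rewrite divr_ge0// ltW.
have cosE : cos (atan (s / t)) = t.
  rewrite cos_atan (_ : 1 + _ = (t^-1) ^+ 2); last first.
    transitivity ((s ^+ 2 + t ^+ 2) / t ^+ 2); first by field; rewrite gt_eqF.
    by rewrite st mul1r exprVn.
  by rewrite sqrtr_sqr gtr0_norm ?invr_gt0// invrK.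
have sinE : sin (atan (s / t)) = s.
  apply: (mulIf (invr_neq0 (lt0r_neq0 t0))).
  by rewrite -{2}cosE; exact: atanK.
by rewrite -[leLHS]sinE sin_le_id// -(@atan0 R) le_atan.
Qed.

(** The density of the slope y/x of two independent Gaussians is the Cauchy
density; the factor |x| is the Jacobian of y = x t. *)
Lemma integral_radial (t : R) :
  (\int[mu]_x (`|x| * (gauss_pdf x * gauss_pdf (x * t)))%:E =
   (pi * (1 + t ^+ 2))^-1%:E)%E.
Proof.
set k := 1 + t ^+ 2.
have k0 : 0 < k by rewrite /k ltr_pwDl// sqr_ge0.
pose c : R := (pi *+ 2)^-1.
have c0 : 0 <= c by rewrite invr_ge0 mulrn_wge0// pi_ge0.
pose E (x : R) := expR (- (x ^+ 2 * (k / 2))).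
have fE x : `|x| * (gauss_pdf x * gauss_pdf (x * t)) = `|x| * (c * E x).
  rewrite gauss_pdfM; congr (_ * (_ * expR _)).
  by rewrite /k; field.
under eq_integral do rewrite fE.
have dE (x : R) : is_derive x 1 E (- (k * x) * E x).
  rewrite /E; apply: is_derive_eq.
  by rewrite /GRing.scale/=; field.
have cE : continuous E.
  move=> x; apply: differentiable_continuous; apply/derivable1_diffP.
  by apply: ex_derive.
have cf : continuous (fun x : R => `|x| * (c * E x)).
  move=> x; apply: cvgM; first exact: norm_continuous.
  by apply: cvgM; [exact: cvg_cst|exact: cE].
rewrite ge0_symfun_integralT//; last 2 first.
- by move=> x; rewrite !mulr_ge0// expR_ge0.
- by move=> x; rewrite /= normrN /E sqrrN.
pose F (x : R) := - (c / k) * E x.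
have dF (x : R) : is_derive x 1 F (x * (c * E x)).
  rewrite /F; apply: is_derive_eq.
  by rewrite /GRing.scale/=; field; rewrite gt_eqF.
rewrite -set_itvcy.
transitivity (2%:E * \int[mu]_(x in `[0%R, +oo[) (x * (c * E x))%:E)%E.
  congr (_ * _)%E; apply: eq_integral => x.
  by rewrite inE/= in_itv/= andbT => x0; rewrite ger0_norm.
rewrite (@ge0_continuous_FTC2y R _ F 0 0).
- rewrite -EFinB -EFinM; congr EFin.
  rewrite /F /E expr0n/= mul0r oppr0 expR0 sub0r mulr1 opprK /c.
  by move: (pi_gt0 R); move: (@pi R) => p p0; field; rewrite !gt_eqF.
- by move=> x x0; rewrite !mulr_ge0// expR_ge0.
- apply: continuous_subspaceT => x; apply: cvgM; first exact: cvg_id.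
  by apply: cvgM; [exact: cvg_cst|exact: cE].
- rewrite -[X in _ --> X](mulr0 (- (c / k))); apply: cvgM; first exact: cvg_cst.
  rewrite /E; apply: (cvg_comp (fun x : R => x ^+ 2 * (k / 2)) (fun x => expR (- x))); last exact: cvgr_expR.
  by apply: gt0_cvgMly; [rewrite divr_gt0|exact: cvgr_expr2].
- by move=> x _; apply: ex_derive.
- apply: cvg_at_right_filter; apply: cvgM; first exact: cvg_cst.
  exact: cE.
- by move=> x _; rewrite derive1E; exact: derive_val.
Qed.

(** Probability that a Cauchy variable exceeds -m. *)
Lemma integral_cauchy_tail (m : R) :
  (\int[mu]_(t in `[(- m)%R, +oo[) ((pi * (1 + t ^+ 2))^-1)%:E =
   (2^-1 + atan m / pi)%:E)%E.
Proof.
have pi0 : pi != 0 :> R by rewrite gt_eqF// pi_gt0.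
rewrite (@ge0_continuous_FTC2y R _ (fun x => pi^-1 * atan x) (- m) (pi^-1 * (pi / 2))).
- by rewrite -EFinB atanN; congr EFin; move: (@pi R) pi0 => p p0; field.
- by move=> x _; rewrite invr_ge0 mulr_ge0 ?pi_ge0// addr_ge0 ?sqr_ge0.
- apply: continuous_subspaceT => x; rewrite /continuous_at.
  under eq_fun do rewrite invfM.
  rewrite invfM; apply: cvgM; first exact: cvg_cst.
  exact: continuous_oneDsqrV.
- by apply: cvgM; [exact: cvg_cst|exact: cvgy_atan].
- by move=> x _; apply: ex_derive.
- apply: cvg_at_right_filter; apply: cvgM; first exact: cvg_cst.
  exact: continuous_atan.
- move=> x _; rewrite derive1E derive_val /GRing.scale/= invfM; ring.
Qed.
End gauss_wedge.

(** * Probability that two Gaussian forms have opposite signs *)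

Section opposite_signs.
Context {R : realType}.
Local Notation mu := (@lebesgue_measure R).
Local Notation RR := (measurableTypeR R).

Definition opposite_signs : set (RR * RR) := [set w | (w.1 * w.2 < 0)%R].

Lemma measurable_opposite_signs : measurable opposite_signs.
Proof.
have mf : measurable_fun setT (fun w : RR * RR => w.1 * w.2 : RR).
  by apply: measurable_funM; [exact: measurable_fst|exact: measurable_snd].
have := mf measurableT `]-oo, 0[%classic (measurable_itv _).
by rewrite setTI; congr measurable; apply/seteqP; split => z /=; rewrite in_itv.
Qed.

Lemma indic_opposite_signs (x y : R) :
  \1_opposite_signs ((x, y) : RR * RR) = (x * y < 0)%R%:R :> R.
Proof.
rewrite indicE; congr (_ %:R); congr nat_of_bool.
by apply/idP/idP; rewrite inE.
Qed.

Lemma gauss_pdfN (x : R) : gauss_pdf (- x) = gauss_pdf x.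
Proof. by rewrite /gauss_pdf !normal_pdfE ?oner_eq0// /normal_fun !subr0 sqrrN. Qed.

Local Open Scope ereal_scope.

(** Substituting y = -+ x t turns the event into the condition t > r/|s| on the
slope alone, and the slope has a Cauchy distribution. *)
Lemma opposite_signs_slope (r s : R) : s != 0%R ->
  \int[gauss]_x \int[gauss]_y (\1_opposite_signs (x, r * x + s * y)%R)%:E =
  (2^-1 + atan (- r / `|s|) / pi)%R%:E.
Proof.
move=> s0; have S0 : (0 < `|s|)%R by rewrite normr_gt0.
set m := (- r / `|s|)%R.
pose F (z : RR * RR) : \bar R := (\1_opposite_signs z)%:E.
have mF : measurable_fun setT F.
  by apply/measurable_EFinP; apply: measurable_indic; exact: measurable_opposite_signs.
pose G (z : RR * RR) := F (1 * z.1 + 0 * z.2, r * z.1 + s * z.2)%R.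
have mG : measurable_fun setT G.
  exact: (measurableT_comp mF (measurable_linear_map _ _ _ _)).
have GE x y : G (x, y) = (x * (r * x + s * y) < 0)%R%:R%:E.
  by rewrite /G/= /F mul1r mul0r addr0 indic_opposite_signs.
have G0 z : 0 <= G z by case: z => x y; rewrite GE lee_fin.
pose K (z : RR * RR) := (\1_`](- m)%R, +oo[ z.2 *
  (`|z.1| * (gauss_pdf z.1 * gauss_pdf (z.1 * z.2))))%R%:E.
have K0 z : 0 <= K z by rewrite lee_fin !mulr_ge0// gauss_pdf_ge0.
have mK : measurable_fun setT K.
  apply/measurable_EFinP; apply: measurable_funM.
    have mi : measurable_fun setT (\1_`](- m)%R, +oo[ : RR -> RR).
      by apply: measurable_indic; exact: measurable_itv.
    exact: (measurableT_comp mi measurable_snd).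
  apply: measurable_funM; first exact: (measurableT_comp (@normr_measurable R setT) measurable_fst).
  apply: measurable_funM; first exact: (measurableT_comp measurable_gauss_pdf measurable_fst).
  apply: (measurableT_comp measurable_gauss_pdf).
  by apply: measurable_funM; [exact: measurable_fst|exact: measurable_snd].
transitivity (\int[mu]_x \int[mu]_t K (x, t)).
  transitivity (\int[gauss]_x \int[gauss]_y G (x, y)).
    by apply: eq_integral => x _; apply: eq_integral => y _; rewrite GE indic_opposite_signs.
  rewrite ge0_integral_gauss; last 2 first.
  - exact: (measurable_fun_fubini_tonelli_F (m2 := gauss) _ mG).
  - by move=> x; exact: integral_ge0.
  apply: eq_integral => x _; rewrite ge0_integral_gauss//; last first.
    exact: (measurableT_comp mG (measurable_pair1 x)).
  have [->|x0] := eqVneq x 0%R.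
    rewrite !integral0_eq ?mul0e//.
    - by move=> t _; rewrite /K/= normr0 mul0r mulr0.
    - by move=> t _; rewrite GE mul0r ltxx mul0e.
  (* With y = a t the second form becomes x (r - |s| t), so that the sign of the
     product no longer depends on x. *)
  pose a := (- Num.sg s * x)%R.
  have a0 : a != 0%R by rewrite mulf_neq0// oppr_eq0 sgr_eq0.
  have na : `|a|%R = `|x|%R by rewrite normrM normrN normr_sg s0 mul1r.
  rewrite (@ge0_integral_affine _ a 0%R (fun y => G (x, y) * (gauss_pdf y)%:E))//; last 2 first.
  - apply: emeasurable_funM; last by apply/measurable_EFinP; exact: measurable_gauss_pdf.
    exact: (measurableT_comp mG (measurable_pair1 x)).
  - by move=> y; rewrite mule_ge0// lee_fin gauss_pdf_ge0.
  rewrite na muleAC -EFinM.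
  have mh : measurable_fun setT (fun y : RR => G (x, y) * (gauss_pdf y)%:E).
    apply: emeasurable_funM; last by apply/measurable_EFinP; exact: measurable_gauss_pdf.
    exact: (measurableT_comp mG (measurable_pair1 x)).
  rewrite -ge0_integralZl//=; last 3 first.
  - exact: (measurableT_comp mh (measurable_affine a 0)).
  - by move=> y _; rewrite mule_ge0// lee_fin gauss_pdf_ge0.
  - by rewrite lee_fin mulr_ge0// gauss_pdf_ge0.
  apply: eq_integral => t _; rewrite addr0 GE /K/= -!EFinM; congr EFin.
  have -> : (x * (r * x + s * (a * t)) = x ^+ 2 * (r - `|s| * t))%R.
    by rewrite [`|s|%R]normrEsg /a; ring.
  have -> : gauss_pdf (a * t)%R = gauss_pdf (x * t)%R.
    have [sp|sn|sz] := ltrgt0P s; last by rewrite sz eqxx in s0.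
      by rewrite /a gtr0_sg// mulN1r mulNr gauss_pdfN.
    by rewrite /a ltr0_sg// opprK mul1r.
  rewrite pmulr_rlt0 ?exprn_even_gt0// subr_lt0 -ltr_pdivrMl// [(_ * r)%R]mulrC.
  rewrite indicE (_ : (t \in _) = (r / `|s| < t)%R); first by ring.
  by apply/idP/idP; rewrite inE/= in_itv/= andbT /m mulNr opprK.
rewrite (fubini_tonelli (m1 := mu) (m2 := mu) K)//.
rewrite -integral_cauchy_tail -integral_itv_obnd_cbnd; last first.
  apply/measurable_EFinP; apply: measurable_funTS; apply: continuous_measurable_fun => x.
  rewrite /continuous_at; under eq_fun do rewrite invfM.
  rewrite invfM; apply: cvgM; first exact: cvg_cst.
  exact: continuous_oneDsqrV.
rewrite [RHS]integral_mkcond; apply: eq_integral => t _.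
rewrite patchE /K/= indicE; case: ifPn => _; last first.
  by rewrite integral0_eq// => x _; rewrite mul0r.
by rewrite -integral_radial; apply: eq_integral => x _; rewrite mul1r.
Qed.

(** For s <> 0 the exact value is 1/2 + asin(-r)/pi.  For s = 0 the two forms are
x and -x, which have opposite signs almost surely. *)
Lemma ge_opposite_signs (r s : R) : (r <= 0)%R -> (r ^+ 2 + s ^+ 2 = 1)%R ->
  (2^-1 - r / pi)%R%:E <=
  \int[gauss]_x \int[gauss]_y (\1_opposite_signs (x, r * x + s * y)%R)%:E.
Proof.
move=> r0 rs; have [s0|s0] := eqVneq s 0%R; last first.
  rewrite opposite_signs_slope// lee_fin -mulNr lerD2l ler_pM2r ?invr_gt0 ?pi_gt0//.
  by apply: le_atan_ratio; rewrite ?oppr_ge0 ?normr_gt0// sqrrN real_normK ?num_real.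
have r1 : r = (- 1)%R.
  move: rs; rewrite s0 expr0n addr0 => /eqP; rewrite sqrf_eq1 => /orP[|] /eqP //.
  by move=> r1; move: r0; rewrite r1 ler10.
have -> : \int[gauss]_x \int[gauss]_y (\1_opposite_signs (x, r * x + s * y)%R)%:E =
    \int[gauss]_x (\1_(~` [set 0%R]) x)%:E.
  apply: eq_integral => x _; rewrite -[RHS]integral_gauss_cst.
  apply: eq_integral => y _; rewrite indic_opposite_signs s0 mul0r addr0 r1 mulN1r.
  rewrite mulrN oppr_lt0 -expr2 lt0r sqr_ge0 andbT sqrf_eq0 indicE.
  have -> // : (x \in ~` [set 0%R]) = (x != 0%R).
  by apply/idP/idP; rewrite inE => /eqP.
have g0 : @gauss R [set 0%R] = 0.
  have /null_content_dominatesP dom : @gauss R `<< mu by exact: normal_prob_dominates.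
  exact: (dom _ (measurable_set1 0%R) (lebesgue_measure_set1 0%R)).
rewrite integral_indic//= ?setIT; last exact: measurableC.
rewrite probability_setC// g0 sube0 lee_fin r1.
rewrite mulN1r opprK -lerBrDl.
have -> : (1 - 2^-1 = 2^-1 :> R)%R by lra.
by rewrite lef_pV2 ?posrE ?pi_gt0// pi_ge2.
Qed.
End opposite_signs.

(** * Random hyperplane rounding *)

Section hyperplane_rounding.
Context {R : realType} {V : finType} {n : nat}.
Local Notation RR := (measurableTypeR R).

(** The distribution p is the law of the set of vertices on the positive side of a
random hyperplane.  Separation of u and v contains the event that the two
Gaussian forms have opposite signs. *)
Lemma hyperplane_rounding (f : V -> 'rV[R]_n) : exists p : {set V} -> R,
  [/\ forall W, 0 <= p W, \sum_W p W = 1 &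
      forall u v, dot (f u) (f u) = 1 -> dot (f v) (f v) = 1 ->
        dot (f u) (f v) <= 0 ->
        2^-1 - dot (f u) (f v) / pi <= \sum_(W : {set V} | (u \in W) != (v \in W)) p W].
Proof.
have [d [T [P [g [mg law]]]]] := @gauss_vector R n.
pose X v (t : T) : RR := \sum_(i < n) f v 0 i * g i t.
have mX v : measurable_fun setT (X v).
  by apply: measurable_sum => i; apply: measurable_funM => //; exact: mg.
pose side t : {set V} := [set v | 0 < X v t]%SET.
have mside v (b : bool) : measurable [set t | (v \in side t) = b].
  have m0 : measurable [set t | 0 < X v t].
    have := mX v measurableT `]0, +oo[%classic (measurable_itv _).
    by rewrite setTI; congr measurable; apply/seteqP; split => t /=; rewrite in_itv/= andbT.
  case: b; last rewrite (_ : mkset _ = ~` [set t | 0 < X v t]); try exact: measurableC.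
    by congr measurable: m0; apply/seteqP; split => t /=; rewrite inE.
  by apply/seteqP; split => t /=; rewrite inE; [move=> -> | move/negP/negbTE].
pose A (W : {set V}) := [set t | side t = W].
have mA W : measurable (A W).
  rewrite (_ : A W = \bigcap_(v in setT) [set t | (v \in side t) = (v \in W)]).
    by apply: fin_bigcap_measurable => //; exact: finite_finset.
  by apply/seteqP; split => [t <- //|t h]; apply/setP => v; exact: h.
pose p W := fine (P (A W)).
have pE W : (p W)%:E = (\int[P]_t (\1_(A W) t)%:E)%E.
  by rewrite fineK ?fin_num_measure// integral_indic// setIT.
(* The events A W partition the space, so the weights of a family of cuts add up
   to the probability that the random cut belongs to it. *)
have indicsum (D : pred {set V}) t : \sum_(W | D W) \1_(A W) t = (D (side t))%:R :> R.
  rewrite big_mkcond/= (bigD1 (side t))//= big1 ?addr0 => [|W Wt].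
    by rewrite indicE mem_set//; case: (D _).
  rewrite indicE memNset; first by case: (D W).
  by move=> /= /esym/eqP; rewrite (negbTE Wt).
have mA1 W : measurable_fun setT (fun t => (\1_(A W) t)%:E : \bar R).
  by apply/measurable_EFinP; exact: measurable_indic.
have psum (D : pred {set V}) :
    ((\sum_(W | D W) p W)%:E = \int[P]_t (D (side t))%:R%:E)%E.
  rewrite -sumEFin; under eq_bigr do rewrite pE.
  rewrite -big_filter -ge0_integral_sum//.
  by apply: eq_integral => t _; rewrite big_filter sumEFin indicsum.
exists p; split.
- by move=> W; exact: fine_ge0.
- apply: EFin_inj; rewrite psum/=; under eq_integral do rewrite /=.
  by rewrite integral_cst//= mul1e probability_setT.
move=> u v fu fv fuv.
rewrite -lee_fin psum.
have [al [be [ga [alE abE bgE lawF]]]] := law (f u 0) (f v 0).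
have {}alE : al ^+ 2 = 1 by rewrite alE -[RHS]fu; apply: eq_bigr => i _; rewrite expr2.
have {}bgE : be ^+ 2 + ga ^+ 2 = 1 by rewrite bgE -[RHS]fv; apply: eq_bigr => i _; rewrite expr2.
have abE' : al * be = dot (f u) (f v) by rewrite abE.
apply: (@le_trans _ _ (\int[gauss]_x \int[gauss]_y
    (\1_opposite_signs (x, dot (f u) (f v) * x + (al * ga) * y)%R)%:E)%E).
  apply: ge_opposite_signs => //.
  by rewrite -abE' !exprMn alE !mul1r.
pose O (z : RR * RR) : \bar R := (\1_opposite_signs z)%:E.
have mO : measurable_fun setT O.
  by apply/measurable_EFinP; apply: measurable_indic; exact: measurable_opposite_signs.
have O0 z : (0 <= O z)%E by rewrite lee_fin indicE.
rewrite (_ : (\int[gauss]_x _ = \int[P]_t O (X u t, X v t))%E); last first.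
  rewrite (lawF _ mO O0).
  apply: eq_integral => x _; apply: eq_integral => y _ /=.
  rewrite /O !indic_opposite_signs; congr (_ %:R)%:E; congr (nat_of_bool (_ < 0)).
  by rewrite -abE'; ring.
apply: ge0_le_integral => //.
- exact: (measurableT_comp mO (measurable_fun_pair (mX u) (mX v))).
- under eq_fun do rewrite -(indicsum (fun W => (u \in W) != (v \in W))) -sumEFin.
  under eq_fun do rewrite -big_filter.
  exact: emeasurable_sum.
- move=> t _; rewrite lee_fin indic_opposite_signs ler_nat.
  case: ltP => //= uv; rewrite !inE.
  move: uv; case: (ltrgt0P (X u t)) => [h|h|->].
  - by rewrite (pmulr_rlt0 _ h); case: ltrgt0P.
  - by rewrite (nmulr_rlt0 _ h); case: ltrgt0P.
  - by rewrite mul0r ltxx.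
Qed.
End hyperplane_rounding.

(** * Fractional cut covers *)

Section fractional_covers.
Context {R : realType} {G : graph}.

Lemma mem_delta (e : edge G) (u v : vertex G) (W : {set vertex G}) :
  ends e = [set u; v]%SET -> (e \in delta W) = ((u \in W) != (v \in W)).
Proof.
move=> euv; have := card_ends e; rewrite euv cards2 => -[/eqP].
rewrite eqb1 => uv; rewrite inE euv finset.setIUl cardsU.
have I1 x : ([set x] :&: W)%SET = if x \in W then [set x]%SET else finset.set0.
  by apply/finset.setP => y; case: ifPn => xW; rewrite !inE; case: eqVneq => // ->; rewrite ?(negbTE xW).
have -> : ([set u] :&: W :&: ([set v] :&: W))%SET = finset.set0.
  apply/finset.setP => y; rewrite !inE; case: (eqVneq y u) => [->|//].
  by rewrite (negbTE uv) andbF.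
rewrite cards0 subn0 !I1; case: (u \in W); case: (v \in W); by rewrite ?cards1 ?cards0.
Qed.

Lemma edge_ends (e : edge G) : exists u v, u != v /\ ends e = [set u; v]%SET.
Proof.
by have /eqP/cards2P := card_ends e.
Qed.

Lemma frac_cut_cover_ge0 : 0 <= frac_cut_cover R G.
Proof.
have [/set0P ne|/negPn/eqP e] := boolP (@cover_ratios R G != set0); last first.
  by rewrite /frac_cut_cover e inf0.
apply: lb_le_inf => // _ [n [k [_ _ _ ->]]].
by rewrite divr_ge0.
Qed.

Lemma frac_cut_cover_le n k (X : n.-tuple {set edge G}) :
  (0 < n)%N -> is_cover k X -> frac_cut_cover R G * k%:R <= n%:R.
Proof.
move=> n0 cX; have [->|k0] := posnP k; first by rewrite mulr0.
rewrite -ler_pdivlMr ?ltr0n//; apply: ge_inf.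
  by exists 0 => _ [n' [k' [_ _ _ ->]]]; rewrite divr_ge0.
by exists n, k; split=> //; exists X.
Qed.

(** A family of multiplicities is a cover written without an ordering. *)
Lemma frac_cut_cover_multiset (m : {set vertex G} -> nat) k :
  (0 < \sum_W m W)%N ->
  (forall e : edge G, k <= \sum_(W | e \in delta W) m W)%N ->
  frac_cut_cover R G * k%:R <= (\sum_W m W)%:R.
Proof.
move=> m0 mk.
pose s := flatten [seq nseq (m W) (delta W) | W <- enum {set vertex G}].
have sE : size s == (\sum_W m W)%N.
  rewrite size_flatten /shape -map_comp sumnE big_map big_enum/=.
  by apply/eqP; apply: eq_bigr => W _; rewrite size_nseq.
apply: (@frac_cut_cover_le _ _ (Tuple sE)) => //; split.
  move=> i; have /flattenP[_ /mapP[W _ ->]] := mem_tnth i (Tuple sE).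
  by move=> /nseqP[-> _]; exists W.
move=> e; apply: (leq_trans (mk e)).
have -> : #|[set i | e \in tnth (Tuple sE) i]%SET| = count (fun X : {set edge G} => e \in X) s.
  transitivity (count (fun X : {set edge G} => e \in X) (map (tnth (Tuple sE)) (enum 'I_(\sum_W m W)))).
    by rewrite count_map -sum1_count big_enum_cond -sum1dep_card.
  by rewrite map_tnth_enum.
rewrite /s count_flatten -map_comp sumnE big_map big_enum/= big_mkcond/=.
by apply: leq_sum => W _; rewrite count_nseq; case: (e \in _); rewrite ?mul1n.
Qed.

(** Giving W the multiplicity floor(N p W) + 1 makes at most N + 2^|V| cuts in
total and at least N q through each edge, so x (N q - 1) <= N + 2^|V| for every
N.  The cost of the roundings is bounded, hence negligible as N grows. *)
Lemma frac_cut_cover_distribution (p : {set vertex G} -> R) (q : R) :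
  (forall W, 0 <= p W) -> \sum_W p W = 1 -> 0 <= q ->
  (forall e : edge G, q <= \sum_(W | e \in delta W) p W) ->
  frac_cut_cover R G * q <= 1.
Proof.
move=> p0 p1 q0 pq; rewrite leNgt; apply/negP => xq.
set x := frac_cut_cover R G in xq *.
have x0 : 0 <= x by exact: frac_cut_cover_ge0.
pose M := #|{set vertex G}|.
have [N NE] : exists N : nat, (M%:R + x) / (x * q - 1) < N%:R.
  by exists (Num.truncn ((M%:R + x) / (x * q - 1))).+1; exact: truncnS_gt.
have {}NE : M%:R + x < N%:R * (x * q - 1).
  by rewrite -ltr_pdivrMr// subr_gt0.
pose m W := (Num.truncn (N%:R * p W)).+1.
pose k := Num.truncn (N%:R * q).
have kq : N%:R * q < k.+1%:R.
  exact: truncnS_gt.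
have km : forall e : edge G, (k <= \sum_(W | e \in delta W) m W)%N.
  move=> e; rewrite -(ler_nat R) natr_sum.
  apply: (@le_trans _ _ (N%:R * q)); first by rewrite truncn_le// mulr_ge0.
  apply: (le_trans (ler_wpM2l _ (pq e))) => //.
  by rewrite mulr_sumr; apply: ler_sum => W _; apply/ltW; rewrite truncnS_gt.
have m0 : (0 < \sum_W m W)%N by rewrite (bigD1 finset.set0).
have := frac_cut_cover_multiset m0 km.
have mle : (\sum_W m W)%:R <= N%:R + M%:R :> R.
  rewrite natr_sum (_ : N%:R = \sum_W N%:R * p W); last by rewrite -mulr_sumr p1 mulr1.
  rewrite (_ : M%:R = \sum_(W : {set vertex G}) 1); last by rewrite sumr_const.
  rewrite -big_split/=; apply: ler_sum => W _.
  by rewrite /m -natr1 lerD2r truncn_le// mulr_ge0.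
rewrite -/x => xk.
have : x * (N%:R * q) <= x * k.+1%:R by rewrite ler_wpM2l// ltW.
rewrite -natr1 mulrDr mulr1 => h.
nra.
Qed.
End fractional_covers.

(** * Gram matrices in small dimension *)

Section gram_realization.
Context {R : realType}.

(** The sign of the first coordinate is chosen so that z stays away from the first
basis vector, as the reflection below requires. *)
Lemma orthogonal_unit_vector (m n : nat) (w : 'I_m -> 'rV[R]_n.+1) : (m <= n)%N ->
  exists z : 'rV[R]_n.+1, [/\ dot z z = 1, z 0 ord0 <= 0 & forall i, dot (w i) z = 0].
Proof.
move=> mn.
pose M : 'M[R]_(n.+1, m) := \matrix_(i, j) w j 0 i.
have kM : kermx M != 0.
  by rewrite -mxrank_eq0 mxrank_ker subn_eq0 -ltnNge ltnS (leq_trans (rank_leq_col M)).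
have [z [z0 zM]] : exists z : 'rV[R]_n.+1, z != 0 /\ z *m M = 0.
  by exists (nz_row (kermx M)); rewrite nz_row_eq0 kM; split=> //; exact/sub_kermxP/nz_row_sub.
have zz0 : 0 < dot z z.
  rewrite lt0r sumr_ge0 ?andbT => [|i _]; last by rewrite -expr2 sqr_ge0.
  apply: contra z0; rewrite psumr_eq0 => [/allP h|i _]; last by rewrite -expr2 sqr_ge0.
  apply/eqP/rowP => i; rewrite mxE; apply/eqP.
  by have := h i (mem_index_enum _); rewrite -expr2 sqrf_eq0.
pose c : R := (if z 0 ord0 <= 0 then 1 else -1) / Num.sqrt (dot z z).
have dotZ x y : dot x (c *: y) = c * dot x y.
  by rewrite /dot mulr_sumr; apply: eq_bigr => i _; rewrite mxE mulrCA.
have dotC (x y : 'rV[R]_n.+1) : dot x y = dot y x.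
  by rewrite /dot; apply: eq_bigr => i _; rewrite mulrC.
have c2 : c ^+ 2 * dot z z = 1.
  rewrite exprMn exprVn sqr_sqrtr ?(ltW zz0)//.
  by rewrite (fun_if (fun x => x ^+ 2)) expr1n sqrrN expr1n if_same mul1r mulVf ?gt_eqF.
exists (c *: z); split.
- by rewrite dotZ dotC dotZ mulrA -expr2.
- rewrite mxE /c mulrAC; apply: mulr_le0_ge0; last by rewrite invr_ge0.
  by case: ifP => [|/negbT]; rewrite ?mul1r// -ltNge mulN1r oppr_le0 => /ltW.
- move=> i; rewrite dotZ (_ : dot _ _ = 0) ?mulr0//.
  have /rowP/(_ i) := zM; rewrite !mxE => <-.
  by apply: eq_bigr => j _; rewrite mxE mulrC.
Qed.

(** The Householder reflection that sends the unit vector z to the first basis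
vector maps the hyperplane orthogonal to z to the vectors with first coordinate
0.  On that hyperplane it adds x_0/(1 - z_0) times z to the other coordinates. *)
Lemma drop_coordinate (m n : nat) (w : 'I_m -> 'rV[R]_n.+1) : (m <= n)%N ->
  exists f : 'I_m -> 'rV[R]_n, forall i j, dot (f i) (f j) = dot (w i) (w j).
Proof.
move=> /(orthogonal_unit_vector w) [z [zz z0 wz]].
pose ka := (1 - z 0 ord0)^-1.
have ka1 : ka * (1 - z 0 ord0) = 1 by rewrite mulVf// gt_eqF// subr_gt0 (le_lt_trans z0).
pose f i : 'rV[R]_n := \row_k (w i 0 (lift ord0 k) + ka * w i 0 ord0 * z 0 (lift ord0 k)).
exists f => i j.
have wz' i' : \sum_(k < n) w i' 0 (lift ord0 k) * z 0 (lift ord0 k) = - (w i' 0 ord0 * z 0 ord0).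
  by apply/eqP; rewrite -addr_eq0 addrC; have := wz i'; rewrite /dot big_ord_recl => ->.
have zz' : \sum_(k < n) z 0 (lift ord0 k) * z 0 (lift ord0 k) = 1 - z 0 ord0 ^+ 2.
  by apply/eqP; rewrite eq_sym subr_eq addrC expr2; have := zz; rewrite /dot big_ord_recl => ->.
rewrite [RHS]/dot big_ord_recl /dot.
set a := w i 0 ord0; set b := w j 0 ord0; set c := z 0 ord0.
transitivity (\sum_(k < n) (w i 0 (lift ord0 k) * w j 0 (lift ord0 k) +
   (ka * b * (w i 0 (lift ord0 k) * z 0 (lift ord0 k)) +
    (ka * a * (w j 0 (lift ord0 k) * z 0 (lift ord0 k)) +
    ka ^+ 2 * a * b * (z 0 (lift ord0 k) * z 0 (lift ord0 k)))))).
  by apply: eq_bigr => k _; rewrite !mxE -/a -/b; ring.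
rewrite !big_split/= -!mulr_sumr !wz' zz' -/a -/b -/c addrC; congr (_ + _).
transitivity (a * b * (ka * (1 - c) * (ka * (1 + c)) - 2 * (ka * c))); first by ring.
rewrite ka1 mul1r; transitivity (a * b * (ka * (1 - c))); first by ring.
by rewrite ka1 mulr1.
Qed.

(** As long as the dimension exceeds the number of vectors, some direction is
orthogonal to all of them and one coordinate can be dropped; in a smaller
dimension, zeros are appended. *)
Lemma gram_realization (m n : nat) (w : 'I_m -> 'rV[R]_n) :
  exists f : 'I_m -> 'rV[R]_m, forall i j, dot (f i) (f j) = dot (w i) (w j).
Proof.
have [mn|nm] := leqP m n.
  rewrite -(subnK mn) in w *; elim: (n - m)%N w => [|d IH] w; first by exists w.
  have [f fE] := drop_coordinate w (leq_addl d m).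
  by have [g gE] := IH f; exists g => i j; rewrite gE fE.
have [d mE] : exists d, m = (n + d)%N by exists (m - n)%N; rewrite subnKC// ltnW.
subst m; exists (fun i => row_mx (w i) 0) => i j.
rewrite /dot big_split_ord/= [X in _ + X]big1 ?addr0 => [|k _].
  by apply: eq_bigr => k _; rewrite !row_mxEl.
by rewrite !row_mxEr mxE mul0r.
Qed.
End gram_realization.

(** * Attainment of the vector minimum *)

Section vector_minimum.
Context {R : realType} {G : graph}.
Local Notation V := (vertex G).
Local Notation N := #|vertex G|.

Lemma norm2_eq1 n (x : 'rV[R]_n) : norm2 x = 1 <-> dot x x = 1.
Proof.
have x0 : 0 <= dot x x by apply: sumr_ge0 => i _; rewrite -expr2 sqr_ge0.
rewrite /norm2; split=> h; last by rewrite h sqrtr1.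
by rewrite -(sqr_sqrtr x0) h expr1n.
Qed.

Lemma card_vertex_gt1 (e : edge G) : (1 < N)%N.
Proof.
have [u [v [uv _]]] := edge_ends e.
by apply/card_gt1P; exists u, v.
Qed.

(** The program is feasible: the vertices of a regular simplex centred at the
origin have equal negative inner products. *)
Lemma simplex_value : (1 < N)%N -> @vector_values R G (- (N%:R - 1)^-1).
Proof.
move=> N1; have N1R : 1 < N%:R :> R by rewrite ltr1n.
have n1 : 0 < N%:R - 1 :> R by rewrite subr_gt0.
have n0 : 0 < N%:R :> R by rewrite (lt_trans ltr01).
split; first by rewrite oppr_lt0 invr_gt0.
pose c : R := Num.sqrt (N%:R / (N%:R - 1)).
have c2 : c ^+ 2 = N%:R / (N%:R - 1) by rewrite sqr_sqrtr// divr_ge0// ltW.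
pose f (v : V) : 'rV[R]_N := \row_i (c * ((enum_rank v == i)%:R - N%:R^-1)).
have fE u v : dot (f u) (f v) = c ^+ 2 * ((u == v)%:R - N%:R^-1).
  rewrite /dot; under eq_bigr do rewrite !mxE.
  transitivity (\sum_(i < N) (c ^+ 2 * ((enum_rank u == i)%:R * (enum_rank v == i)%:R)
     + (- (c ^+ 2 / N%:R)) * (enum_rank u == i)%:R + (- (c ^+ 2 / N%:R)) * (enum_rank v == i)%:R + c ^+ 2 / N%:R ^+ 2)).
    by apply: eq_bigr => i _; field; rewrite gt_eqF.
  have one w : \sum_(i < N) (enum_rank w == i)%:R = 1 :> R.
    rewrite (bigD1 (enum_rank w))//= eqxx big1 ?addr0// => i.
    by rewrite eq_sym => /negbTE ->.
  rewrite !big_split/= -!mulr_sumr !one sumr_const card_ord.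
  have -> : \sum_(i < N) (enum_rank u == i)%:R * (enum_rank v == i)%:R = (u == v)%:R :> R.
    rewrite (bigD1 (enum_rank u))//= eqxx mul1r (inj_eq enum_rank_inj) eq_sym big1 ?addr0// => i.
    by rewrite eq_sym => /negbTE ->; rewrite mul0r.
  by rewrite -[_^-1 *+ N]mulr_natr; field; rewrite gt_eqF.
exists f; split=> [v|e u v euv].
  apply/norm2_eq1; rewrite fE eqxx c2 /=; field.
  by rewrite !gt_eqF.
have uv : u != v by have := card_ends e; rewrite euv cards2; case: eqVneq.
rewrite fE (negbTE uv) c2 /= le_eqVlt; apply/orP; left; apply/eqP; field.
by rewrite !gt_eqF.
Qed.

(** The minimum is sought among bounds t that are at most the value of the simplex.
A candidate, vectors and bound together, is a single real function h on a finite
index type, where h None is the bound.  The box [-1, 1]^(V x N) x [-1, t1] is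
compact by Tychonoff's theorem, the constraints are closed, and h None is
continuous. *)
Lemma vector_tP : (0 < #|edge G|)%N ->
  @vector_values R G (vector_t R G) /\ lbound (@vector_values R G) (vector_t R G).
Proof.
move=> /card_gt0P[e0 _]; have N1 := card_vertex_gt1 e0.
suff [t tP] : exists t, (@vector_values R G `&` lbound (@vector_values R G)) t.
  by have := xgetI 0 tP.
have v1 := simplex_value N1; set t1 : R := - (_)^-1 in v1.
pose I : eqType := option (V * 'I_N).
pose row (h : I -> R) (v : V) : 'rV[R]_N := \row_i h (Some (v, i)).
pose box := [set h : I -> R | forall o, (if o is Some _ then `[(-1), 1] else `[(-1), t1])%classic (h o)].
pose C1 := [set h : I -> R | forall v, dot (row h v) (row h v) = 1].
pose C2 := [set h : I -> R | forall e u v, ends e = [set u; v]%SET ->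
  dot (row h u) (row h v) <= h None].
pose T := prod_topology (fun _ : I => R).
have cbox : @compact T box.
  apply: (@tychonoff I (fun _ => R) (fun o => (if o is Some _ then `[(-1), 1] else `[(-1), t1])%classic)).
  by case=> [?|]; exact: segment_compact.
have cproj o : continuous (fun h : T => h o) by exact: (@proj_continuous I (fun _ => R) o).
have cdot u v : continuous (fun h : T => dot (row h u) (row h v)).
  rewrite (_ : (fun h : T => _) = fun h : T => \sum_(i < N) h (Some (u, i)) * h (Some (v, i))).
    apply: continuous_big => [|i _ h]; first exact: add_continuous.
    exact: (continuousM (cproj (Some (u, i)) h) (cproj (Some (v, i)) h)).
  by apply/funext => h; apply: eq_bigr => i _; rewrite !mxE.
have clC1 : @closed T C1.
  rewrite (_ : C1 = \bigcap_(v in setT) ((fun h : T => dot (row h v) (row h v)) @^-1` [set 1])).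
    apply: closed_bigI => v _; apply: preimage_closed; last exact: closed_eq.
    by move=> h _; exact: cdot.
  by apply/seteqP; split => [h hC v _|h hC v]; [exact: hC|exact: (hC v)].
have clC2 : @closed T C2.
  rewrite (_ : C2 = \bigcap_(w in [set w : V * V | exists e, ends e = [set w.1; w.2]%SET])
      ((fun h : T => h None - dot (row h w.1) (row h w.2)) @^-1` [set x | 0 <= x])).
    apply: closed_bigI => w _; apply: preimage_closed; last exact: closed_ge.
    by move=> h _; exact: (continuousB (cproj None h) (cdot w.1 w.2 h)).
  apply/seteqP; split => [h hC [u v] [e /= eE]|h hC e u v eE].
    by rewrite subr_ge0; exact: (hC e).
  by rewrite -subr_ge0; apply: (hC (u, v)); exists e.
have cK : @compact T (box `&` (C1 `&` C2)).
  by apply: compact_closedI => //; exact: closedI.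
have dot_entry n (x : 'rV[R]_n) i : dot x x = 1 -> x 0 i \in `[(-1), 1].
  move=> x1; rewrite in_itv/= -ler_norml -sqrtr_sqr -[leRHS]sqrtr1 ler_wsqrtr// -x1.
  rewrite /dot (bigD1 i)//= -expr2 lerDl sumr_ge0// => j _.
  by rewrite -expr2 sqr_ge0.
have dot_ge n (x y : 'rV[R]_n) : dot x x = 1 -> dot y y = 1 -> -1 <= dot x y.
  move=> x1 y1; have : 0 <= \sum_i (x 0 i + y 0 i) ^+ 2 by apply: sumr_ge0 => i _; exact: sqr_ge0.
  rewrite (_ : \sum_i _ = dot x x + (2 * dot x y + dot y y)); first by rewrite x1 y1; lra.
  rewrite /dot mulr_sumr -!big_split/=; apply: eq_bigr => i _; ring.
have inK t f : t <= t1 -> (forall v, norm2 (f v) = 1) ->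
    (forall (e : edge G) u v, ends e = [set u; v]%SET -> dot (f u) (f v) <= t) ->
    (box `&` (C1 `&` C2)) (fun o => if o is Some (v, i) then f v 0 i else t).
  move=> tt1 f1 fe.
  have rowE v : row (fun o => if o is Some (v, i) then f v 0 i else t) v = f v.
    by apply/rowP => i; rewrite mxE.
  split; last by split; [move=> v; rewrite rowE; exact/norm2_eq1|move=> e u v eE; rewrite !rowE; exact: fe eE].
  case=> [[v i]|]; first by apply: dot_entry; exact/norm2_eq1.
  rewrite /= in_itv/= tt1 andbT.
  have [u [v [_ eE]]] := edge_ends e0.
  by apply: le_trans (fe e0 u v eE); apply: dot_ge; exact/norm2_eq1.
have K0 : (box `&` (C1 `&` C2)) !=set0.
  by case: v1 => _ [f [f1 fe]]; exists (fun o => if o is Some (v, i) then f v 0 i else t1); exact: inK.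
have [h] := @compact_EVT_min T R (fun h : T => h None) _ K0 cK (continuous_subspaceT (cproj None)).
rewrite inE => -[hbox [hC1 hC2]] hmin.
have ht1 : h None <= t1 by have /andP[] := hbox None.
exists (h None); split.
  split; first by apply: le_lt_trans ht1 _; case: v1.
  by exists (row h); split=> [v|e u v eE]; [exact/norm2_eq1|exact: hC2 eE].
move=> t [t0 [f [f1 fe]]].
have [tt1|/ltW tt1] := leP t t1; last exact: le_trans tt1.
have /mem_set/hmin := inK t f tt1 f1 fe; exact.
Qed.

End vector_minimum.

(** * Comparison of the two numbers *)

Section bounds.
Context {R : realType} {G : graph}.
Local Notation V := (vertex G).

Lemma cover_ratios_neq0 : @cover_ratios R G !=set0.
Proof.
pose n := #|{set V}|.
pose X : n.-tuple {set edge G} := [tuple delta (enum_val i) | i < n].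
have n0 : (0 < n)%N by apply/card_gt0P; exists finset.set0.
exists (n%:R / 1%:R), n, 1%N; split=> //; exists X; split=> [i|e].
  by rewrite tnth_mktuple; exists (enum_val i).
have [u [v [uv eE]]] := edge_ends e.
apply/card_gt0P; exists (enum_rank [set u]%SET).
rewrite inE tnth_mktuple enum_rankK (mem_delta _ eE) !inE eqxx.
by rewrite [v == u]eq_sym (negbTE uv).
Qed.

(** An edge cut by c of the n cuts has ends whose sign vectors agree in n - c places
and differ in c, hence inner product 1 - 2c/n after normalization. *)
Lemma cover_vectors n k (X : n.-tuple {set edge G}) : (0 < n)%N -> is_cover k X ->
  exists f : V -> 'rV[R]_#|V|, (forall v, norm2 (f v) = 1) /\
    forall (e : edge G) u v, ends e = [set u; v]%SET ->
      dot (f u) (f v) <= 1 - 2 * (k%:R / n%:R).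
Proof.
move=> n0 [cX kX]; have n0R : n%:R != 0 :> R by rewrite pnatr_eq0 -lt0n.
have [W WE] : exists W : 'I_n -> {set V}, forall i, tnth X i = delta (W i).
  exact: (fin_all_exists cX).
pose s v i : R := if v \in W i then 1 else -1.
pose c : R := (Num.sqrt n%:R)^-1.
have c2 : c ^+ 2 = n%:R^-1 by rewrite exprVn sqr_sqrtr.
pose w v : 'rV[R]_n := \row_i (c * s v i).
have wE u v : dot (w u) (w v) = n%:R^-1 * \sum_i s u i * s v i.
  by rewrite /dot mulr_sumr; apply: eq_bigr => i _; rewrite !mxE mulrACA -expr2 c2.
have [g gE] := gram_realization (fun j : 'I_#|V| => w (enum_val j)).
exists (fun v => g (enum_rank v)); split=> [v|e u v eE].
  apply/norm2_eq1; rewrite gE wE.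
  rewrite (eq_bigr (fun _ => 1)) => [|i _]; last by rewrite /s; case: ifP => _; rewrite ?mulrNN mulr1.
  by rewrite sumr_const card_ord mulVf.
rewrite gE wE !enum_rankK.
rewrite (eq_bigr (fun i => 1 - 2 * (e \in tnth X i)%:R)) => [|i _]; last first.
  rewrite WE (mem_delta _ eE) /s; case: (u \in W i); case: (v \in W i) => /=; lra.
rewrite sumrB sumr_const card_ord -mulr_sumr -natr_sum mulrBr mulVf// lerD2l lerN2.
rewrite [leRHS]mulrCA ler_pM2l// mulrC ler_pM2l ?invr_gt0 ?ltr0n// ler_nat.
apply: leq_trans (kX e) _.
by rewrite -sum1dep_card big_mkcond/=; apply: leq_sum => i _; case: (e \in _).
Qed.

(** If n/k >= 2 the bound holds since t < 0; otherwise 1 - 2k/n is a negative value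
of the vector program. *)
Lemma frac_cut_cover_ge_vector (t : R) : t < 0 ->
  lbound (@vector_values R G) t -> 2 / (1 - t) <= frac_cut_cover R G.
Proof.
move=> t0 tmin; have t1 : 0 < 1 - t by rewrite subr_gt0 (lt_trans t0).
apply: lb_le_inf; first exact: cover_ratios_neq0.
move=> _ [n [k [n0 k0 [X cX] ->]]].
have nR : 0 < n%:R :> R by rewrite ltr0n.
have kR : 0 < k%:R :> R by rewrite ltr0n.
rewrite ler_pdivrMr// mulrAC ler_pdivlMr//.
have kE : k%:R = k%:R / n%:R * n%:R :> R by rewrite divfK// gt_eqF.
have [neg|pos] := ltP (1 - 2 * (k%:R / n%:R)) (0 : R).
  have : t <= 1 - 2 * (k%:R / n%:R).
    by apply: tmin; split=> //; exact: cover_vectors cX.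
  by rewrite kE; move: (k%:R / n%:R) => y ty; nra.
by move: pos; rewrite [X in _ -> 2 * X <= _]kE; move: (k%:R / n%:R) => y y2; nra.
Qed.

Lemma frac_cut_cover_le_vector (t : R) : @vector_values R G t ->
  frac_cut_cover R G * (2^-1 - t / pi) <= 1.
Proof.
move=> [t0 [f [f1 ft]]].
have pi0 := pi_gt0 R.
have [p [p0 p1 pf]] := hyperplane_rounding f.
apply: (frac_cut_cover_distribution p0 p1).
  by rewrite subr_ge0 (@le_trans _ _ 0)// pmulr_lle0 ?invr_gt0// ltW.
move=> e; have [u [v [uv eE]]] := edge_ends e.
have h := ft e u v eE.
apply: (@le_trans _ _ (2^-1 - dot (f u) (f v) / pi)).
  by rewrite lerD2l lerN2 ler_pM2r ?invr_gt0.
rewrite (eq_bigl _ _ (fun W => mem_delta W eE)).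
by apply: pf; [exact/norm2_eq1|exact/norm2_eq1|exact: le_trans h (ltW t0)].
Qed.

End bounds.

Theorem theorem5p2 (R : realType) (G : graph) (hE : (0 < #|edge G|)%N) :
  vector_chi R G <= cubical_chi R G /\
  cubical_chi R G <= pi / 2 * vector_chi R G.
Proof.
have [tV tmin] := @vector_tP R G hE.
have t0 : vector_t R G < 0 by case: tV.
have lo := frac_cut_cover_ge_vector t0 tmin.
have up := frac_cut_cover_le_vector tV.
rewrite /vector_chi /cubical_chi.
move: (frac_cut_cover R G) (vector_t R G) lo up t0 {tV tmin} => x t lo up t0.
have p2 := pi_ge2 R; move: (@pi R) p2 up => p p2 up.
pose s := - t; have s0 : 0 < s by rewrite oppr_gt0.
have p0 : 0 < p by lra.
have -> : t = - s by rewrite opprK.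
have {}up : x * (p + 2 * s) <= 2 * p.
  have -> : x * (p + 2 * s) = 2 * p * (x * (2^-1 - t / p)) by rewrite /s; field; rewrite gt_eqF.
  by rewrite ger_pMr// mulr_gt0.
have {}lo : 2 <= x * (1 + s) by move: lo; rewrite ler_pdivrMr ?/s ?subr_gt0 ?(lt_trans t0).
have x2 : x < 2 by nra.
have d0 : 0 < 2 - x by rewrite subr_gt0.
have -> : 1 - 1 / - s = (1 + s) / s by field; rewrite gt_eqF.
split.
  by rewrite ler_pdivrMr// mulrAC ler_pdivlMr//; nra.
rewrite ler_pdivrMr//.
have -> : p / 2 * ((1 + s) / s) * (2 - x) = (p * (1 + s) * (2 - x)) / (2 * s).
  by field; rewrite gt_eqF.
rewrite ler_pdivlMr ?mulr_gt0//.
have : 4 * s <= (2 - x) * (p + 2 * s) by nra.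
have : (2 - x) * (p + 2 * s) <= (2 - x) * (p * (1 + s)).
  by rewrite ler_pM2l//; nra.
lra.
Qed.
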